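(* Let $p,q$ be distinct primes and $H$ a finite group. Then the following are equivalent: (1) $H$ is isomorphic to a subgroup of $D_{p,q}^k$ for some integer $k$. (2) $H$ is of weak $D_{p,q}$-type. (3) $\lambda_q(\lambda_p(H)) = \{e\}$. (4) $H$ is isomorphic to $(\mathbb{Z}/q\mathbb{Z})^n \rtimes_\rho (\mathbb{Z}/p\mathbb{Z})^m$ for some integers $n,m\ge 0$ and some action $\rho : (\mathbb{Z}/p\mathbb{Z})^m \to \mathrm{GL}_n(\mathbb{Z}/q\mathbb{Z})$.
   Context: For distinct primes $p,q$, let $\zeta_p$ be a primitive $p$-th root of unity in $\overline{\mathbb{F}}_q$ and let $\mathbb{Z}/p\mathbb{Z}$ act on the additive group $\mathbb{F}_q(\zeta_p)$ by letting $i$ act as multiplication by $\zeta_p^i$. $D_{p,q} := \mathbb{F}_q(\zeta_p)\rtimes \mathbb{Z}/p\mathbb{Z}$ is the corresponding semidirect product. For a finite group $G$ and a prime $\ell$, $\lambda_\ell(G) = [G,G]G^\ell$ is the subgroup generated by all commutators and all $\ell$-th powers of elements of $G$. A group $H$ is of weak $G$-type if there is an integer $n$ such that $H$ is isomorphic to a subquotient (quotient of a subgroup) of $G^n$. *)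

(* Defs.v *)
From HB Require Import structures.
From mathcomp Require Import all_boot all_order all_algebra.
From mathcomp Require Import all_fingroup all_solvable all_field all_character.

Set Implicit Arguments.
Unset Strict Implicit.
Unset Printing Implicit Defensive.

Import GRing.Theory.
Local Open Scope ring_scope.

(* A primitive p-th root of unity z of the algebraic closure of 'F_q lies in a
   finite extension L of 'F_q, and conversely every finite extension embeds in
   the closure.  So z ranges over the primitive p-th roots of unity of an
   arbitrary finite extension L, and F_q(zeta_p) is the subfield <<1; z>> of
   L.  Such L and z exist: *)
Lemma prim_root_extension (p q : nat) :
    prime p -> prime q -> p <> q ->
  exists (L : fieldExtType 'F_q) (z : L), p.-primitive_root z.
Proof.
move=> p_pr q_pr neq_pq; have p_gt0 := prime_gt0 p_pr.
have nzP : 'X^p - 1 != 0 :> {poly 'F_q}.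
  by rewrite -size_poly_eq0 -polyC1 size_XnsubC.
have [L [rs eq_rs _]] := FinSplittingFieldFor nzP.
have nzpL : p%:R != 0 :> L.
  have qL : q \in [pchar L] by rewrite pchar_lalg pchar_Fp.
  by rewrite -(dvdn_pcharf qL) dvdn_prime2 // eq_sym; apply/eqP.
have PE : map_poly (in_alg L) ('X^p - 1) = 'X^p - 1 :> {poly L}.
  by rewrite rmorphB rmorph1 /= map_polyXn.
rewrite PE in eq_rs; exists L.
suffices /hasP[z _ z_prim] : has p.-primitive_root rs by exists z.
apply: has_prim_root => //.
- apply/allP=> x rs_x; rewrite unity_rootE -root_prod_XsubC in rs_x *.
  by move: rs_x; rewrite -(eqp_root eq_rs) /root !hornerE subr_eq0.
- by rewrite -separable_prod_XsubC -(eqp_separable eq_rs) separable_Xn_sub_1.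
- by rewrite -ltnS -(size_prod_XsubC rs id) -(eqp_size eq_rs) -polyC1 size_XnsubC.
Qed.

Section CyclotomicSemidirect.

Variables (p q : nat) (L : fieldExtType 'F_q) (z : L).
Hypotheses (p_pr : prime p) (z_prim : p.-primitive_root z).

(* F_q(z); finvect_type supplies the finite, hence the additive finGroupType,
   structure. *)
Definition cyc_field : finFieldType := finvect_type (subvs_of <<1; z>>%AS).

Definition cyc_zeta : cyc_field := Subvs (memv_adjoin 1%AS z).

Definition cyc_act (x : cyc_field) (i : 'F_p) : cyc_field := cyc_zeta ^+ i * x.

Lemma cyc_zetaX : cyc_zeta ^+ p = 1.
Proof.
have -> : cyc_zeta ^+ p = Subvs (memv_adjoin 1%AS z) ^+ p by [].
by apply/val_inj; rewrite rmorphXn /= algid1 (prim_expr_order z_prim).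
Qed.

Lemma cyc_act_is_action : is_action [set: 'F_p] cyc_act.
Proof.
apply: is_total_action => [x|x i j]; first by rewrite /cyc_act expr0 mul1r.
rewrite /cyc_act mulrA -exprD addnC -(expr_mod (i + j) cyc_zetaX).
by have modp (k : nat) : (k %% (Zp_trunc (pdiv p)).+2 = k %% p)%N by [rewrite Fp_cast]; rewrite -modp.
Qed.

Definition cyc_action := Action cyc_act_is_action.

Lemma cyc_act_is_groupAction : is_groupAction [set: cyc_field] cyc_action.
Proof.
move=> i _ /[1!inE]; apply/andP; split; first by apply/subsetP=> x /[!inE].
by apply/morphicP=> x y _ _; rewrite !actpermE /= /cyc_act mulrDr.
Qed.

Definition cyc_groupAction := GroupAction cyc_act_is_groupAction.

Definition Dpq : finGroupType := sdprod_by cyc_groupAction.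

End CyclotomicSemidirect.

Local Open Scope group_scope.

Definition gpow (gT : finGroupType) (n : nat) : finGroupType :=
  {dffun forall _ : 'I_n, gT}.

Definition weak_type (gT rT : finGroupType) (H : {group rT}) : Prop :=
  exists (n : nat) (A B : {group gpow gT n}), B <| A /\ H \isog A / B.

Definition lambda (l : nat) (gT : finGroupType) (G : {set gT}) : {group gT} :=
  <<commg_set G G :|: [set x ^+ l | x in G]>>%G.

(* Main.v *)
Require Import Defs.
From mathcomp Require Import all_boot all_order all_algebra.
From mathcomp Require Import all_fingroup all_solvable all_field all_character.

(** For (2) => (3), [lambda] commutes with morphisms and [D_{p,q}] has an
    elementary abelian normal q-subgroup with elementary abelian p-quotient.
    For (3) => (4), [lambda_p(H)] is a normal Hall q-subgroup, so
    Schur-Zassenhaus splits it off.  For (4) => (1), it suffices to separate the points of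
    [V ><| P], where [V = F_q^n] and [P = F_p^m], by morphisms to [D_{p,q}]; the
    characters of [P] are [x |-> zeta^(c . x)], and each coordinate [phi] of the
    projection of [V] to the isotypic component of [c] in [F_q(zeta)^n] gives the
    morphism [(x, u) |-> (c . x, phi u)].  Summing these projections over all [c]
    recovers [u], so some [phi u] is nonzero whenever [u] is. *)

Set Implicit Arguments.
Unset Strict Implicit.
Unset Printing Implicit Defensive.

Import GroupScope GRing.Theory FinRing.Theory.

(** * Functoriality of [lambda] and elementary abelian quotients *)

Lemma lambdaS (l : nat) (gT : finGroupType) (A B : {set gT}) :
  A \subset B -> lambda l A \subset lambda l B.
Proof. by move=> sAB; rewrite genS // setUSS ?imset2S ?imsetS. Qed.

Lemma lambda_sub (l : nat) (gT : finGroupType) (G : {group gT}) :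
  lambda l G \subset G.
Proof.
rewrite gen_subG subUset; apply/andP; split.
  by apply/subsetP=> _ /imset2P[x y Gx Gy ->]; rewrite groupR.
by apply/subsetP=> _ /imsetP[x Gx ->]; rewrite groupX.
Qed.

Lemma morphim_lambda (l : nat) (aT rT : finGroupType) (G H : {group aT})
    (f : {morphism G >-> rT}) :
  H \subset G -> f @* lambda l H = lambda l (f @* H).
Proof.
move=> sHG; rewrite morphim_gen; last first.
  exact: subset_trans (subset_gen _) (subset_trans (lambda_sub l H) sHG).
congr <<_>>; rewrite morphimU; congr (_ :|: _).
  apply/setP=> y; apply/morphimP/imset2P=> [[x Gx /imset2P[a b Ha Hb ->] ->]|].
    exists (f a) (f b); rewrite ?mem_morphim ?(subsetP sHG) //.
    by rewrite morphR ?(subsetP sHG).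
  case=> _ _ /morphimP[a Ga Ha ->] /morphimP[b Gb Hb ->] ->.
  by exists [~ a, b]; rewrite ?groupR ?morphR //; apply/imset2P; exists a b.
apply/setP=> y; apply/morphimP/imsetP=> [[x Gx /imsetP[a Ha ->] ->]|].
  exists (f a); rewrite ?mem_morphim ?(subsetP sHG) //.
  by rewrite morphX ?(subsetP sHG).
case=> _ /morphimP[a Ga Ha ->] ->.
by exists (a ^+ l); rewrite ?groupX ?morphX //; apply/imsetP; exists a.
Qed.

Lemma morphim_lambda2 (k l : nat) (aT rT : finGroupType) (G H : {group aT})
    (f : {morphism G >-> rT}) :
  H \subset G -> f @* lambda k (lambda l H) = lambda k (lambda l (f @* H)).
Proof.
move=> sHG; rewrite morphim_lambda ?morphim_lambda //.
exact: subset_trans (lambda_sub l H) sHG.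
Qed.

Lemma lambda_normal (l : nat) (gT : finGroupType) (G : {group gT}) :
  lambda l G <| G.
Proof.
by apply: sub_der1_normal; rewrite ?lambda_sub // genS // subsetUl.
Qed.

Lemma lambda_eq1 (l : nat) (gT : finGroupType) (G : {group gT}) :
  prime l -> (lambda l G \subset [1]) = l.-abelem G.
Proof.
move=> l_pr; rewrite abelemE // gen_subG subUset -gen_subG; congr (_ && _).
  by rewrite (sameP trivgP commG1P).
apply/subsetP/exponentP=> [sX1 x Gx | X1 _ /imsetP[x Gx ->]].
  by apply/set1P/sX1/imset_f.
by rewrite X1 ?inE.
Qed.

(** By functoriality, passing to [G / N] turns the inclusion into the triviality of
    [lambda l (G / N)]. *)
Lemma lambda_sub_abelem (l : nat) (gT : finGroupType) (G N : {group gT}) :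
  prime l -> G \subset 'N(N) -> (lambda l G \subset N) = l.-abelem (G / N).
Proof.
move=> l_pr nNG; have nNL := subset_trans (lambda_sub l G) nNG.
by rewrite -quotient_sub1 // -lambda_eq1 // /quotient morphim_lambda.
Qed.

(** Each coordinate projection is a morphism to [gT], so it kills [lambda k (lambda l A)], and a
    tuple with trivial coordinates is trivial. *)
Lemma lambda_gpow_eq1 (k l n : nat) (gT : finGroupType)
    (A : {group gpow gT n}) :
  lambda k (lambda l [set: gT]) = 1 :> {set gT} ->
  lambda k (lambda l A) = 1 :> {set gpow gT n}.
Proof.
move=> lam1; apply/trivgP/subsetP=> x lam_x; apply/set1P/ffunP=> i.
suffices: x i \in lambda k (lambda l [set: gT]) by rewrite lam1 ffunE => /set1P.
pose f := @dffun_morphism _ (fun=> gT) i.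
have: f @* lambda k (lambda l A) \subset lambda k (lambda l [set: gT]).
  by rewrite morphim_lambda2 ?subsetT // !lambdaS ?subsetT.
by move/subsetP; apply; apply: mem_morphim; rewrite ?inE.
Qed.

(** The quotient [G / V] is isomorphic to [P], which forces [lambda l G] into [V]. *)
Lemma lambda_sdprod_eq1 (k l : nat) (gT : finGroupType) (G V P : {group gT}) :
    prime k -> prime l -> V ><| P = G -> k.-abelem V -> l.-abelem P ->
  lambda k (lambda l G) = 1 :> {set gT}.
Proof.
move=> k_pr l_pr defG abelV abelP; have [nVG _ _ _ _] := sdprod_context defG.
apply/trivgP; rewrite lambda_eq1 //; apply: abelemS abelV.
rewrite lambda_sub_abelem ?normal_norm //.
by rewrite -(isog_abelem (sdprod_isog defG)).
Qed.

(** * Split extensions in linear coordinates *)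

Lemma abelem_rV_repr (q : nat) (gT : finGroupType) (E G : {group gT}) :
    q.-abelem E -> G \subset 'N(E) ->
  exists n (f : {morphism [set: 'rV['F_q]_n] >-> gT})
      (r : mx_representation 'F_q G n),
    [/\ 'injm f, f @* [set: 'rV_n] = E
      & {in G, forall x v, f (v *m r x)%R = f v ^ x}].
Proof.
(* The dimension ['dim E] is always a successor, so the trivial group is treated apart, in dimension
   0. *)
move=> abelE nEG; have [E1 | ntE] := eqsVneq E 1; last first.
  pose f := @Morphism _ _ [set: 'rV['F_q]_('dim E)] _
    (in2W (rVabelemD abelE ntE)).
  exists _, f, (abelem_repr abelE ntE nEG); split=> [||x Gx v].
  - by apply/injmP=> u v _ _; apply: rVabelem_inj.
  - rewrite morphimEdom; apply/setP=> x.
    apply/imsetP/idP=> [[v _ ->] | Ex]; first exact: mem_rVabelem.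
    by exists (abelem_rV abelE ntE x); rewrite ?inE //= abelem_rV_K.
  - exact: rVabelemJ.
have r1 : mx_repr G (fun _ => 1%:M : 'M['F_q]_0)%R.
  by split=> // x y _ _; rewrite mulmx1.
exists 0, (triv_morph _ _), (MxRepresentation r1); split=> [||x _ v].
- by apply/injmP=> u v _ _ _; rewrite [u]thinmx0 [v]thinmx0.
- by rewrite morphim_trivm E1.
- by rewrite /= conj1g.
Qed.

Lemma abelem_sdprod_isog (p q : nat) (gT : finGroupType) (G V P : {group gT}) :
    prime p -> V ><| P = G -> q.-abelem V -> p.-abelem P ->
  exists (n m : nat) (rho : mx_representation 'F_q [set: 'rV['F_p]_m] n),
    G \isog [set: sdprod_by ('MR rho)%gact].
Proof.
move=> p_pr defG abelV abelP.
have [/andP[_ nVG] sPG defVP nVP tiVP] := sdprod_context defG.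
have [n [f [r [injf imf fJ]]]] := abelem_rV_repr abelV nVP.
(* Coordinates [g] on [P] come from its conjugation action on itself; the action on [V] is then [r]
   transported along [g]. *)
have [m [g [_ [injg img _]]]] := abelem_rV_repr abelP (normG P).
have Pg x : g x \in P by rewrite -img mem_morphim ?inE.
have rg : mx_repr [set: 'rV['F_p]_m] (r \o g).
  split=> [|x y _ _] /=; first by rewrite morph1 repr_mx1.
  by rewrite morphM ?inE // repr_mxM.
exists n, m, (MxRepresentation rg).
have act_fg : {in [set: 'rV['F_q]_n] & [set: 'rV['F_p]_m],
    morph_act ('MR (MxRepresentation rg))%gact 'J f g}.
  by move=> v x _ _; rewrite /= mx_repr_actE ?inE //= fJ.
rewrite isog_sym; apply/isogP; exists (xsdprod_morphism act_fg).
  by rewrite injm_xsdprodm injf injg imf img tiVP eqxx.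
by rewrite im_xsdprodm imf img.
Qed.

Lemma lambda_eq1_sdprod (p q : nat) (gT : finGroupType) (G : {group gT}) :
    prime p -> prime q -> p != q -> lambda q (lambda p G) = 1 :> {set gT} ->
  exists P : {group gT},
    [/\ lambda p G ><| P = G, q.-abelem (lambda p G) & p.-abelem P].
Proof.
move=> p_pr q_pr neq_pq /trivgP; rewrite lambda_eq1 // => abelL.
have nsLG := lambda_normal p G.
have abelGL : p.-abelem (G / lambda p G).
  by rewrite -lambda_sub_abelem ?normal_norm.
have hallL : Hall G (lambda p G).
  apply: (@pHall_Hall _ q); rewrite /pHall normal_sub ?abelem_pgroup //=.
  rewrite -card_quotient ?normal_norm //.
  (* The index is a power of [p], hence prime to [q]. *)
  apply: sub_in_pnat (abelem_pgroup abelGL) => r _ /eqnP->.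
  by rewrite !inE.
have /splitsP[P /complP[tiLP defLP]] := SchurZassenhaus_split hallL nsLG.
have defG : lambda p G ><| P = G.
  rewrite sdprodE //; apply: subset_trans (normal_norm nsLG).
  by rewrite -defLP mulG_subr.
by exists P; split=> //; rewrite (isog_abelem (sdprod_isog defG)).
Qed.

(** * Isotypic projections for representations of [F_p^m] *)

Section CharacterProjection.

Local Open Scope ring_scope.

Variables (p : nat) (F : finFieldType) (K : fieldType).
Variables (iota : {rmorphism F -> K}) (zeta : K).
Hypotheses (p_pr : prime p) (zeta_prim : p.-primitive_root zeta).

Lemma prim_expFpD (a b : 'F_p) : zeta ^+ (a + b)%R = zeta ^+ a * zeta ^+ b.
Proof.
rewrite -exprD -[RHS](expr_mod _ (prim_expr_order zeta_prim)).
suffices <-: (a + b)%R = ((a + b) %% p)%N :> nat by [].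
by rewrite /= [X in (_ %% X)%N]Fp_cast.
Qed.

Variables (m n : nat) (rho : mx_representation F [set: 'rV['F_p]_m] n).

Definition dotFp (c x : 'rV['F_p]_m) : 'F_p := (c *m x^T) 0 0.

Lemma dotFpDl (c d x : 'rV_m) : dotFp (c + d) x = dotFp c x + dotFp d x.
Proof. by rewrite /dotFp mulmxDl mxE. Qed.

Lemma dotFpDr (c x y : 'rV_m) : dotFp c (x + y) = dotFp c x + dotFp c y.
Proof. by rewrite /dotFp linearD mulmxDr mxE. Qed.

Lemma dotFp_delta (i : 'I_m) (x : 'rV_m) : dotFp (delta_mx 0 i) x = x 0 i.
Proof. by rewrite /dotFp -rowE !mxE. Qed.

(** Orthogonality of characters: if [x] has a nonzero coordinate [i], translating [c] by the basis
    vector [d] multiplies the sum by [zeta ^+ (x 0 i)], which differs from 1, so the sum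
    vanishes. *)
Lemma sum_prim_dotFp (x : 'rV_m) :
  \sum_c zeta ^+ dotFp c x = if x == 0 then (p ^ m)%:R else 0.
Proof.
have [-> | /rV0Pn[i nz_xi]] := eqVneq.
  rewrite -[p in RHS](card_Fp p_pr) -[m in RHS]mul1n -card_mx -sum1_card natr_sum.
  by apply: eq_bigr => c _; rewrite /dotFp trmx0 mulmx0 mxE.
set S := \sum_c _; pose d : 'rV['F_p]_m := delta_mx 0 i.
have: S = zeta ^+ dotFp d x * S.
  rewrite mulr_sumr {1}/S (reindex_inj (addrI d)) /=.
  by apply: eq_bigr => c _; rewrite dotFpDl prim_expFpD.
move/eqP; rewrite -subr_eq0 -[X in X - _]mul1r -mulrBl mulf_eq0 subr_eq0.
rewrite eq_sym -(prim_order_dvd zeta_prim) dotFp_delta.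
have lt_xi: (x 0%R i < p)%N by rewrite -[X in (_ < X)%N](Fp_cast p_pr).
by rewrite gtnNdvd ?lt0n // => /eqP.
Qed.

(* Up to the factor p^m, the projection of K^n onto the isotypic component of
   the character x |-> zeta^(c . x). *)
Definition char_proj (c : 'rV['F_p]_m) (u : 'rV[F]_n) : 'rV[K]_n :=
  \sum_(x : 'rV_m) zeta ^+ dotFp c (- x) *: map_mx iota (u *m rho x).

Lemma char_projD (c : 'rV_m) (u v : 'rV_n) :
  char_proj c (u + v) = char_proj c u + char_proj c v.
Proof.
rewrite -big_split; apply: eq_bigr => x _.
by rewrite mulmxDl map_mxD scalerDr.
Qed.

(** Shifting the summation index by [- y] absorbs [rho y]. This eigenvector property makes each
    coordinate of [char_proj c] compatible with the action in [Dpq]. *)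
Lemma char_proj_repr (c y : 'rV_m) (u : 'rV_n) :
  char_proj c (u *m rho y) = zeta ^+ dotFp c y *: char_proj c u.
Proof.
rewrite /char_proj scaler_sumr (reindex_inj (addrI (- y))); apply: eq_bigr => x _.
rewrite scalerA -prim_expFpD -dotFpDr opprD opprK -mulmxA.
by rewrite -repr_mxM ?inE // zmodMgE addNKr.
Qed.

(** After the sums are exchanged, orthogonality leaves only the term at 0, where [rho] is the
    identity. *)
Lemma sum_char_proj (u : 'rV_n) :
  \sum_c char_proj c u = (p ^ m)%:R *: map_mx iota u.
Proof.
rewrite exchange_big (bigD1 0) //= -scaler_suml oppr0 sum_prim_dotFp eqxx.
rewrite [rho 0](repr_mx1 rho) mulmx1 big1 ?addr0 // => x nz_x.
by rewrite -scaler_suml sum_prim_dotFp oppr_eq0 (negPf nz_x) scale0r.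
Qed.

Lemma char_proj_neq0 (u : 'rV_n) : u != 0 -> exists c j, char_proj c u 0 j != 0.
Proof.
move=> nz_u; have nz_p : p%:R != 0 :> K.
  (* A field of characteristic [p] has no primitive [p]-th root of unity. *)
  apply/eqP=> p0; have := prim_root_pcharF zeta_prim (dvdnn p).
  by rewrite inE p_pr p0 eqxx.
have: \sum_c char_proj c u != 0.
  by rewrite sum_char_proj scaler_eq0 natrX expf_eq0 (negPf nz_p) andbF map_mx_eq0.
case: (pickP (fun c => char_proj c u != 0)) => [c /rV0Pn[j nz_j] _ | proj0].
  by exists c, j.
by rewrite big1 ?eqxx // => c _; apply/eqP/negbFE/proj0.
Qed.

End CharacterProjection.

(** * Embeddings into powers, and morphisms out of semidirect products *)

Lemma isog_gpow_of_separating (gT rT : finGroupType) (G : {group rT}) :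
    (forall x, x \in G -> x != 1 -> exists f : {morphism G >-> gT}, f x != 1) ->
  exists (k : nat) (K : {group gpow gT k}), G \isog K.
Proof.
(* The exponent is the size of [T], finite because its members are finite functions. Evaluation at
   all of them at once is injective on [G]. *)
move=> sepG; pose T := {f : {ffun rT -> gT} | morphic G f}.
pose h x : gpow gT #|{: T}| := [ffun i => val (enum_val i : T) x].
have hM : {in G &, {morph h : x y / x * y}}.
  move=> x y Gx Gy; apply/ffunP=> i; rewrite !ffunE.
  exact: morphicP (valP (enum_val i : T)) x y Gx Gy.
exists #|{: T}|, (Morphism hM @* G)%G; apply: sub_isog => //.
apply/subsetP=> x; rewrite !inE => /andP[Gx /eqP/= hx1].
apply: contraT => /(sepG x Gx)[f nt_fx].
have fM : morphic G [ffun y => f y : gT].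
  by apply/morphicP=> y z Gy Gz; rewrite !ffunE morphM.
pose g : T := exist (fun g : {ffun rT -> gT} => is_true (morphic G g)) _ fM.
move/ffunP/(_ (enum_rank g)): hx1.
by rewrite !ffunE enum_rankK /= ffunE => /eqP/idPn.
Qed.

(** On each factor, [xsdprodm] inverts the pairing injection and applies the given morphism. The
    acting factor comes first, to match [sdpairE]. *)
Lemma xsdprodmE (gT aT rT : finGroupType) (H : {group gT}) (K : {group aT})
    (to : groupAction K H) (fH : {morphism H >-> rT}) (fK : {morphism K >-> rT})
    (actf : {in H & K, morph_act to 'J fH fK}) :
  {in K & H, forall a x,
    xsdprodm actf (sdpair2 to a * sdpair1 to x) = fK a * fH x}.
Proof.
move=> a x Ka Hx; rewrite morphM ?inE //; congr (_ * _).
  by rewrite [LHS]sdprodmEr ?mem_morphim //= /restrm /= invmE.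
by rewrite [LHS]sdprodmEl ?mem_morphim //= /restrm /= invmE.
Qed.

(** * The group [Dpq] and morphisms into it *)

Section DpqTheory.

Variables (p q : nat) (L : fieldExtType 'F_q) (z : L).
Hypotheses (p_pr : prime p) (q_pr : prime q) (z_prim : (p.-primitive_root z)%R).

Lemma cyc_zeta_prim : (p.-primitive_root (cyc_zeta z))%R.
Proof.
rewrite -(fmorph_primitive_root (vsval : {rmorphism subvs_of <<1; z>>%AS -> L})).
exact: z_prim.
Qed.

Lemma lambda_Dpq_eq1 :
  lambda q (lambda p [set: Dpq p_pr z_prim]) = 1 :> {set Dpq p_pr z_prim}.
Proof.
apply: lambda_sdprod_eq1 (sdprod_sdpair _) _ _ => //; apply: morphim_abelem.
  apply: fin_ring_pchar_abelem.
  by rewrite (pchar_lalg (finvect_type (subvs_of <<1; z>>%AS))) pchar_Fp.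
by apply: fin_ring_pchar_abelem; rewrite pchar_Fp.
Qed.

(** Write [s] as a pair [(x, u)]. If [x] is nonzero, one of its coordinates detects [s], with all of
    [F_q^n] sent to 1; otherwise [u] is nonzero and a coordinate of some [char_proj c u] detects
    it. *)
Lemma sdprod_separated (n m : nat)
    (rho : mx_representation 'F_q [set: 'rV['F_p]_m] n)
    (s : sdprod_by ('MR rho)%gact) : s != 1 ->
  exists f : {morphism [set: sdprod_by ('MR rho)%gact] >-> Dpq p_pr z_prim},
    f s != 1.
Proof.
pose iota : {rmorphism 'F_q -> cyc_field z} :=
  in_alg (finvect_type (subvs_of <<1; z>>%AS)).
pose D := cyc_groupAction p_pr z_prim.
have dotM c : {in [set: 'rV['F_p]_m] &,
    {morph (fun x => sdpair2 D (dotFp c x)) : x y / x * y}}.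
  by move=> x y _ _; rewrite dotFpDr [LHS]morphM ?inE.
have act1 c : {in [set: 'rV['F_q]_n] & [set: 'rV['F_p]_m],
    morph_act ('MR rho)%gact 'J (trivm [set: 'rV['F_q]_n]) (Morphism (dotM c))}.
  by move=> u x _ _; rewrite /= conj1g.
have projM c j : {in [set: 'rV['F_q]_n] &,
    {morph (fun u => sdpair1 D (char_proj iota (cyc_zeta z) rho c u 0%R j)) :
      x y / x * y}}.
  by move=> u v _ _; rewrite char_projD mxE [LHS]morphM ?inE.
have act2 c j : {in [set: 'rV['F_q]_n] & [set: 'rV['F_p]_m],
    morph_act ('MR rho)%gact 'J (Morphism (projM c j)) (Morphism (dotM c))}.
  (* Conjugation by the image of [x] multiplies by the power of zeta that appears in
     [char_proj_repr]. *)
  move=> u x _ _; rewrite /= -sdpair_act ?inE // mx_repr_actE ?inE //.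
  by rewrite char_proj_repr ?cyc_zeta_prim // mxE.
rewrite [s]sdpairE; case: s => [[x u] /= _].
have [-> | /rV0Pn[i nz_xi] _] := eqVneq x 0%R; last first.
  exists (xsdprod_morphism (act1 (delta_mx 0 i)%R)).
  rewrite /= xsdprodmE ?inE //= mulg1 dotFp_delta.
  by rewrite morph_injm_eq1 ?inE ?injm_sdpair2.
rewrite morph1 mul1g morph_injm_eq1 ?inE ?injm_sdpair1 // => nz_u.
have [c [j nz_cj]] := char_proj_neq0 iota p_pr cyc_zeta_prim rho nz_u.
exists (xsdprod_morphism (act2 c j)).
rewrite /= -[sdpair1 _ u]mul1g -(morph1 (sdpair2_morphism _)) xsdprodmE ?inE //=.
rewrite [X in X * _](morph1 (Morphism (dotM c))) mul1g.
by rewrite morph_injm_eq1 ?inE ?injm_sdpair1.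
Qed.

End DpqTheory.

Theorem proposition2p13
  (p q : nat) (p_pr : prime p) (q_pr : prime q) (neq_pq : p <> q)
  (L : fieldExtType 'F_q) (z : L) (z_prim : (p.-primitive_root z)%R)
  (hT : finGroupType) (H : {group hT}) :
  [<-> exists (k : nat) (K : {group gpow (Dpq p_pr z_prim) k}), (H \isog K)%g;
       weak_type (Dpq p_pr z_prim) H;
       lambda q (lambda p H) = 1%g :> {set hT};
       exists (n m : nat)
         (rho : mx_representation 'F_q [set: 'rV['F_p]_m] n),
         (H \isog [set: sdprod_by ('MR rho)%gact])%g].
Proof.
tfae.
- move=> [k [K isoHK]]; exists k, K, 1%G; split; first exact: normal1.
  by rewrite (isog_trans isoHK) // quotient1_isog.
(* The inverse isomorphism makes [H] an image of [A / B], so triviality passes down from [A]. *)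
- move=> [n [A [B [nsBA /isog_symr/isogP[f _ <-]]]]].
  rewrite -morphim_lambda2 // /quotient -morphim_lambda2 ?normal_norm //.
  by rewrite (lambda_gpow_eq1 _ (lambda_Dpq_eq1 p_pr q_pr z_prim)) !morphim1.
- move=> lamH; have [|P [defH abelV abelP]] := lambda_eq1_sdprod p_pr q_pr _ lamH.
    exact/eqP.
  exact: abelem_sdprod_isog p_pr defH abelV abelP.
move=> [n [m [rho isoH]]].
(* The embedding is built for the matrix model and then transferred to [H]. *)
have [|k [K isoK]] := @isog_gpow_of_separating (Dpq p_pr z_prim) _
  [set: sdprod_by ('MR rho)%gact]%G.
  by move=> s _; apply: sdprod_separated.
by exists k, K; apply: isog_trans isoH isoK.
Qed.
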